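(* Let $A$ be a Banach algebra and let $n\ge 2$ be an even number such that $\tilde Z_1^\ell(A^{(n)})=A^{(n)}$. If $A^{(n)}$ is weakly amenable, then $A^{(n-2)}$ is weakly amenable.
   Context: $A^{(k)}$ is the $k$-th dual of $A$, $A^{(0)}=A$. For even $k\ge 2$, $A^{(k)}=(A^{(k-2)})^{**}$ is a Banach algebra under the first Arens product built from the product of $A^{(k-2)}$; for a Banach algebra $C$ this product on $C^{**}$ is given by $\langle c'c,d\rangle=\langle c',cd\rangle$, $\langle c''c',c\rangle=\langle c'',c'c\rangle$, $\langle c''d'',c'\rangle=\langle c'',d''c'\rangle$ ($c,d\in C$, $c'\in C^*$, $c'',d''\in C^{**}$). $\tilde Z_1^\ell(A^{(n)})$ is the set of $a\in A^{(n)}$ such that $b\mapsto ab$ is weak*-to-weak continuous from $A^{(n)}$ to $A^{(n)}$, with weak* $=\sigma(A^{(n)},A^{(n-1)})$ and weak $=\sigma(A^{(n)},A^{(n+1)})$. For a Banach algebra $C$, $C^*$ is a $C$-bimodule by $\langle c'c,d\rangle=\langle c',cd\rangle$, $\langle cc',d\rangle=\langle c',dc\rangle$. A derivation $D:C\to C^*$ is a bounded linear map with $D(xy)=xD(y)+D(x)y$; it is inner if $D(c)=cc'-c'c$ for some fixed $c'\in C^*$. $C$ is weakly amenable if every derivation $C\to C^*$ is inner. *)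

(* Defs.v *)
From HB Require Import structures.
From mathcomp Require Import all_boot all_order all_algebra.
From mathcomp Require Import mathcomp_extra boolp classical_sets functions reals.
From mathcomp Require Import topology normedtype.
From mathcomp Require Import complex.

Set Implicit Arguments.
Unset Strict Implicit.
Unset Printing Implicit Defensive.

Import Order.TTheory GRing.Theory Num.Theory.
Import numFieldNormedType.Exports.

Local Open Scope classical_set_scope.
Local Open Scope ring_scope.

(* Fields of scalars.  A numFieldType whose real elements satisfy the
   least-upper-bound axiom is, by the Gelfand-Mazur theorem, a copy of the real
   or of the complex numbers; the lemmas below check that both qualify.  Stating
   everything over such a K treats real and complex Banach algebras at once.
   The norm of a normedModType K takes its values in K itself. *)
Definition real_complete (K : numFieldType) : Prop :=
  forall E : set K, E `<=` [set x | x \is Num.real] -> has_sup E ->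
    supremums E !=set0.

Lemma real_complete_realType (R : realType) : real_complete R.
Proof.
move=> E _ [E0 [M EM]]; exists (sup E); split.
  by move=> x Ex; apply: ub_le_sup => //; exists M.
by move=> y yE; apply: ge_sup.
Qed.

Lemma real_complete_complex (R : realType) : real_complete R[i].
Proof.
have realE (z : R[i]) : z \is Num.real -> z = (complex.Re z)%:C%C.
  by move=> /complex_realP[x ->].
move=> E Er [E0 [M EM]].
have EM' x : E x -> complex.Re x <= complex.Re M.
  by move=> /EM; rewrite lecE => /andP[].
have Fub : has_ubound [set complex.Re z | z in E].
  by exists (complex.Re M) => _ [z Ez <-]; exact: EM'.
have F0 : [set complex.Re z | z in E] !=set0.
  by have [z Ez] := E0; exists (complex.Re z), z.
exists (sup [set complex.Re z | z in E])%:C%C; split.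
  move=> z Ez; rewrite (realE z (Er _ Ez)) lecR.
  by apply: ub_le_sup => //; exists z.
move=> y yE; have [z Ez] := E0.
have yr : y \is Num.real.
  have zy := yE _ Ez.
  by rewrite -(subrK z y); apply: rpredD; [rewrite ger0_real// subr_ge0|exact: Er].
rewrite (realE y yr) lecR; apply: ge_sup => // _ [w Ew <-].
by have := yE _ Ew; rewrite {1}(realE w (Er _ Ew)) (realE y yr) lecR.
Qed.

Definition bounded_linear (K : numFieldType) (V W : normedModType K)
    (f : V -> W) : Prop :=
  linear f /\ exists M : K, forall x, `|f x| <= M * `|x|.

Definition dual_pred (K : numFieldType) (V : normedModType K) : {pred (V -> K^o)} :=
  mem [set f : V -> K^o | bounded_linear f].

Arguments dual_pred {K} V.

(* Topological dual.  The proof hK is a phantom parameter of the type: it is what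
   makes the supremum in the operator norm exist, so it must be recoverable from
   the type for the normed module instance to be canonical. *)
Record dual (K : numFieldType) (hK : real_complete K) (V : normedModType K) : Type :=
  Dual { dual_val :> V -> K^o ; dual_valP : dual_val \in dual_pred V }.

Arguments Dual {K} hK {V dual_val} dual_valP.
Arguments dual_val {K hK V} _ _.

Section DualModule.
Variables (K : numFieldType) (hK : real_complete K) (V : normedModType K).
Local Notation dual := (dual hK V).
Local Notation dual_val := (@dual_val K hK V).
Local Notation dual_pred := (dual_pred V).

HB.instance Definition _ := [isSub for dual_val].
HB.instance Definition _ := [Choice of dual by <:].

Lemma bounded_linear_geP (f : V -> K^o) : bounded_linear f ->
  exists2 M : K, 0 <= M & forall x, `|f x| <= M * `|x|.
Proof.
move=> [_ [M hM]]; exists `|M| => // x.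
have h0 : 0 <= M * `|x| by exact: le_trans (hM x).
by apply: le_trans (hM x) _; rewrite -(ger0_norm h0) normrM normr_id.
Qed.

Lemma dual_submod_closed : submod_closed dual_pred.
Proof.
split.
  apply: mem_set; split=> [k x y|]; first by rewrite [LHS]/(0 : K) scaler0 addr0.
  by exists 0 => x; rewrite [X in `|X|]/(0 : K) normr0 mul0r.
move=> k f g /set_mem fP /set_mem gP; apply: mem_set; split.
  move=> l x y; rewrite [LHS]/(k * f _ + g _) fP.1 gP.1.
  have E (p q r s : K) : k * (l * p + q) + (l * r + s) = l * (k * p + r) + (k * q + s).
    by rewrite !mulrDr addrACA !mulrA (mulrC k l).
  exact: E.
have [M M0 hM] := bounded_linear_geP fP; have [N N0 hN] := bounded_linear_geP gP.
exists (`|k| * M + N) => x; rewrite [X in `|X|]/(k * f x + g x).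
by rewrite (le_trans (ler_normD _ _))// mulrDl lerD// normrM -mulrA ler_wpM2l.
Qed.

HB.instance Definition _ :=
  GRing.isSubmodClosed.Build _ _ dual_pred dual_submod_closed.
HB.instance Definition _ := [SubChoice_isSubLmodule of dual by <:].

Implicit Types f g : dual.

Definition dual_norm (f : dual) : K :=
  supremum 0 [set `|f x| | x in [set x : V | `|x| <= 1]].

Lemma dual_linear f : linear f.
Proof. by have /set_mem[] := dual_valP f. Qed.

Lemma dualD f x y : f (x + y) = f x + f y.
Proof. by have := dual_linear f 1 x y; rewrite !scale1r. Qed.

Lemma dual0 f : f 0 = 0.
Proof. by apply: (@addrI _ (f 0)); rewrite -dualD !addr0. Qed.

Lemma dualZ f k x : f (k *: x) = k * f x.
Proof. by have := dual_linear f k x 0; rewrite dual0 !addr0. Qed.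

Lemma dualB f x y : f (x - y) = f x - f y.
Proof. by rewrite -scaleN1r dualD dualZ mulN1r. Qed.

Lemma dual_addE f g x : (f + g) x = f x + g x. Proof. by []. Qed.
Lemma dual_scaleE k f x : (k *: f) x = k * f x. Proof. by []. Qed.
Lemma dual_zeroE x : (0 : dual) x = 0. Proof. by []. Qed.
Lemma dual_subE f g x : (f - g) x = f x - g x. Proof. by []. Qed.

Lemma dual_ext f g : f =1 g -> f = g.
Proof. by move=> fg; apply: val_inj; apply/funext. Qed.

Lemma dual_norm_supremums f :
  supremums [set `|f x| | x in [set x : V | `|x| <= 1]] (dual_norm f).
Proof.
set E := [set _ | _ in _].
have E0 : E !=set0 by exists `|f 0|; exists 0 => //=; rewrite normr0.
have /cid [s sE] : supremums E !=set0.
  apply: hK; first by move=> _ [x _ <-]; exact: normr_real.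
  split=> //; have /set_mem/bounded_linear_geP[M M0 hM] := dual_valP f.
  exists M => _ [x /= x1 <-]; apply: le_trans (hM x) _.
  by rewrite ler_piMr.
rewrite /dual_norm /supremum -/E; case: ifPn => [/eqP EE|_].
  by move: E0; rewrite EE => -[].
by case: xgetP => [y -> //|/(_ s)].
Qed.

Lemma dual_norm_ge0 f : 0 <= dual_norm f.
Proof.
have [ub _] := dual_norm_supremums f; apply: le_trans (normr_ge0 (f 0)) _.
by apply: ub; exists 0 => //=; rewrite normr0.
Qed.

Lemma ler_dual_norm f x : `|f x| <= dual_norm f * `|x|.
Proof.
have [->|x0] := eqVneq x 0; first by rewrite dual0 !normr0 mulr0.
have nx0 : 0 < `|x| by rewrite normr_gt0.
have [ub _] := dual_norm_supremums f.
rewrite -ler_pdivrMr//; apply: ub; exists (`|x|^-1 *: x) => /=.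
  by rewrite normrZ ger0_norm ?invr_ge0// mulVf ?gt_eqF.
by rewrite dualZ normrM ger0_norm ?invr_ge0// mulrC.
Qed.

Lemma dual_norm_le f (M : K) : 0 <= M -> (forall x, `|f x| <= M * `|x|) ->
  dual_norm f <= M.
Proof.
move=> M0 hM; have [_ lb] := dual_norm_supremums f; apply: lb => _ [x /= x1 <-].
by apply: le_trans (hM x) _; rewrite ler_piMr.
Qed.

Lemma dual_normD f g : dual_norm (f + g) <= dual_norm f + dual_norm g.
Proof.
apply: dual_norm_le => [|x]; first by rewrite addr_ge0 ?dual_norm_ge0.
by rewrite dual_addE (le_trans (ler_normD _ _))// mulrDl lerD// ler_dual_norm.
Qed.

Lemma dual_normZ k f : dual_norm (k *: f) = `|k| * dual_norm f.
Proof.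
have leZ l h : dual_norm (l *: h) <= `|l| * dual_norm h.
  apply: dual_norm_le => [|x]; first by rewrite mulr_ge0 ?dual_norm_ge0.
  by rewrite dual_scaleE normrM -mulrA ler_wpM2l// ler_dual_norm.
apply/eqP; rewrite eq_le leZ /=.
have [->|k0] := eqVneq k 0; first by rewrite normr0 mul0r dual_norm_ge0.
have nk0 : 0 < `|k| by rewrite normr_gt0.
rewrite -ler_pdivlMl// -normfV.
by rewrite -{1}[f]scale1r -(mulVf k0) -scalerA leZ.
Qed.

Lemma dual_norm0_eq0 f : dual_norm f = 0 -> f = 0.
Proof.
move=> f0; apply: dual_ext => x; apply/normr0_eq0/eqP.
by rewrite eq_le normr_ge0 andbT (le_trans (ler_dual_norm f x))// f0 mul0r.
Qed.

HB.instance Definition _ :=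
  Lmodule_isNormed.Build K dual dual_normD dual_normZ dual_norm0_eq0.

Lemma dual_normE f : `|f| = dual_norm f. Proof. by []. Qed.

Lemma ler_dual f x : `|f x| <= `|f| * `|x|.
Proof. exact: ler_dual_norm. Qed.

End DualModule.

Section DualComplete.
Variables (K : numFieldType) (hK : real_complete K) (V : completeNormedModType K).
Local Notation V' := (dual hK V).

Lemma dual_continuous (f : V') : continuous (f : V -> K^o).
Proof.
move=> x; apply/cvgrPdist_lt => e e0.
have f1 : 0 < `|f| + 1 by rewrite ltr_wpDl.
have d0 : 0 < (`|f| + 1)^-1 * e by rewrite mulr_gt0// invr_gt0.
near=> y.
rewrite -dualB (le_lt_trans (ler_dual f (x - y)))//.
apply: le_lt_trans (_ : (`|f| + 1) * `|x - y| < e).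
  by rewrite ler_wpM2r// lerDl.
by rewrite -ltr_pdivlMl//; near: y; exact: (@cvgr_dist_lt _ _ _ _ _ (fun y => y)).
Unshelve. all: by end_near. Qed.

(* Completeness of V already forces that of K as soon as V has a nonzero
   functional, so no completeness assumption on K as a metric space is needed. *)
Lemma scalar_complete (g : V') (v : V) : g v != 0 ->
  forall G : set_system K^o, ProperFilter G -> cauchy G -> cvg G.
Proof.
move=> gv0 G PG cG.
pose h (k : K^o) : V := (k / g v) *: v.
have gh k : g (h k) = k by rewrite /h dualZ divfK.
have cH : cauchy (h @ G).
  apply/cauchyP => e e0.
  have v1 : 0 < `|(g v)^-1| * `|v| + 1 by rewrite ltr_wpDl// mulr_ge0.
  have /cauchyP/(_ (e / (`|(g v)^-1| * `|v| + 1))) [|k0 hk0] := cG.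
    by rewrite divr_gt0.
  exists (h k0); rewrite /nbhs /=; near=> k.
  rewrite -ball_normE /ball_ /= /h -scalerBl -mulrBl normrZ normrM -mulrA.
  have : `|k0 - k| < e / (`|(g v)^-1| * `|v| + 1).
    by near: k; move: hk0; rewrite -ball_normE.
  rewrite ltr_pdivlMr// => /(le_lt_trans _); apply.
  by rewrite ler_wpM2l// lerDl.
have /cvg_ex[w hw] : cvg (h @ G) by exact: cauchy_cvg cH.
apply/cvg_ex; exists (g w).
have : (g : V -> K^o) \o h @ G --> g w.
  by apply: cvg_comp hw _; exact: dual_continuous.
by apply: cvg_trans; apply: near_eq_cvg; near=> k; rewrite /= gh.
Unshelve. all: by end_near. Qed.

Lemma dual_complete (F : set_system V') : ProperFilter F -> cauchy F -> cvg F.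
Proof.
move=> PF cF.
have [[g [v gv0]]|nog] := pselect (exists (g : V') v, g v != 0); last first.
  apply/cvg_ex; exists 0 => A /nbhs_singleton A0.
  suff -> : A = setT by exact: filterT.
  apply/seteqP; split=> // f _; suff -> : f = 0 by [].
  apply: dual_ext => x; apply/eqP; apply: contrapT => /negP fx.
  by apply: nog; exists f, x.
have Kc := scalar_complete gv0.
have cx e : 0 < e -> exists f0 : V', \forall f \near F, `|f0 - f| < e.
  move=> e0; have /cauchyP/(_ e e0)[f0 hf0] := cF.
  by exists f0; move: hf0; rewrite -ball_normE.
have cL x : exists l : K^o, (fun f : V' => f x : K^o) @ F --> l.
  apply/cvg_ex; apply: Kc; apply/cauchyP => e e0.
  have x1 : 0 < `|x| + 1 by rewrite ltr_wpDl.
  have [f0 hf0] := cx (e / (`|x| + 1)) (divr_gt0 e0 x1).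
  exists (f0 x); rewrite /nbhs /=; near=> f.
  rewrite -ball_normE /ball_ /= -dual_subE.
  apply: le_lt_trans (ler_dual _ _) _.
  have : `|f0 - f| < e / (`|x| + 1) by near: f.
  rewrite ltr_pdivlMr// => /(le_lt_trans _); apply.
  by rewrite ler_wpM2l// lerDl.
have [L hL] := choice cL.
have Ldist e f0 x : (\forall f \near F, `|f0 - f| < e) ->
    `|(f0 x : K) - L x| <= e * `|x|.
  move=> hf0; apply/ler_addgt0Pl => d d0.
  have /cvgrPdist_lt/(_ d d0) hd := hL x.
  near F => f.
  have -> : (f0 x : K) - L x = - ((L x : K) - f x) + (f0 - f) x.
    have E (a b c : K) : a - c = - (c - b) + (a - b).
      by rewrite opprB [RHS]addrC addrA subrK.
    exact: E.
  rewrite (le_trans (ler_normD _ _))// lerD//.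
    by rewrite normrN ltW//; near: f.
  apply: le_trans (ler_dual _ _) _; rewrite ler_wpM2r// ltW//.
  by near: f.
have Llin : linear (L : V -> K^o).
  move=> k x y; apply: (@cvg_unique _ _ ((fun f : V' => f (k *: x + y) : K^o) @ F)).
  - exact: norm_hausdorff.
  - exact: hL.
  - have -> : (fun f : V' => f (k *: x + y) : K^o) =
              (fun f : V' => k *: (f x : K^o) + (f y : K^o)).
      by apply/funext => f; rewrite dualD dualZ.
    by apply: cvgD; [apply: cvgZr; exact: hL|exact: hL].
have [f1 hf1] := cx 1 ltr01.
have LP : (L : V -> K^o) \in dual_pred V.
  apply: mem_set; split=> //; exists (`|f1| + 1) => x.
  have -> : L x = (f1 x : K) - ((f1 x : K) - L x) by rewrite opprB addrC subrK.
  rewrite mulrDl (le_trans (ler_normB _ _))// lerD ?ler_dual//.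
  exact: Ldist.
apply/cvg_ex; exists (Dual hK LP); apply/cvgrPdist_le => e e0.
have e20 : 0 < e / 2 by rewrite divr_gt0.
have [f0 hf0] := cx _ e20.
near=> f.
have -> : Dual hK LP - f = - (f0 - Dual hK LP) + (f0 - f).
  by rewrite opprB addrA subrK.
rewrite (le_trans (ler_normD _ _))// [leRHS](splitr e) lerD//.
  rewrite normrN dual_normE; apply: dual_norm_le; first exact: ltW.
  by move=> x; exact: Ldist.
by rewrite ltW//; near: f.
Unshelve. all: by end_near. Qed.

HB.instance Definition _ := Uniform_isComplete.Build V' dual_complete.

End DualComplete.

(* No unit is required. *)
HB.mixin Record isBanachAlgebra (K : numFieldType) V
    & CompleteNormedModule K V := {
  bmul : V -> V -> V;
  bmulA : associative bmul;
  bmulDl : left_distributive bmul +%R;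
  bmulDr : right_distributive bmul +%R;
  bmulZl : forall (k : K) x y, bmul (k *: x) y = k *: bmul x y;
  bmulZr : forall (k : K) x y, bmul x (k *: y) = k *: bmul x y;
  ler_bmul : forall x y, `|bmul x y| <= `|x| * `|y|
}.

#[short(type="banachAlgType")]
HB.structure Definition BanachAlgebra (K : numFieldType) :=
  {V of CompleteNormedModule K V & isBanachAlgebra K V}.

Section Actions.
Variables (K : numFieldType) (hK : real_complete K) (C : banachAlgType K).
Local Notation C' := (dual hK C).
Local Notation C'' := (dual hK C').

Lemma dual_actr_subproof (f : C') (c : C) :
  (fun d => f (bmul c d) : K^o) \in dual_pred C.
Proof.
apply: mem_set; split; first by move=> k x y; rewrite bmulDr bmulZr dual_linear.
exists (`|f| * `|c|) => x; rewrite -mulrA (le_trans (ler_dual _ _))//.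
by rewrite ler_wpM2l// ler_bmul.
Qed.

Lemma dual_actl_subproof (c : C) (f : C') :
  (fun d => f (bmul d c) : K^o) \in dual_pred C.
Proof.
apply: mem_set; split; first by move=> k x y; rewrite bmulDl bmulZl dual_linear.
exists (`|f| * `|c|) => x; rewrite -mulrA (le_trans (ler_dual _ _))//.
by rewrite ler_wpM2l// mulrC ler_bmul.
Qed.

(* <f.c, d> = <f, cd> *)
Definition dual_actr (f : C') (c : C) : C' := Dual hK (dual_actr_subproof f c).

(* <c.f, d> = <f, dc> *)
Definition dual_actl (c : C) (f : C') : C' := Dual hK (dual_actl_subproof c f).

Lemma dual_actrE f c d : dual_actr f c d = f (bmul c d). Proof. by []. Qed.

Lemma dual_actlE c f d : dual_actl c f d = f (bmul d c). Proof. by []. Qed.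

Lemma ler_dual_actr f c : `|dual_actr f c| <= `|f| * `|c|.
Proof.
rewrite dual_normE; apply: dual_norm_le => [|x]; first by rewrite mulr_ge0.
by rewrite dual_actrE -mulrA (le_trans (ler_dual _ _))// ler_wpM2l// ler_bmul.
Qed.

Lemma bidual_act_subproof (u : C'') (f : C') :
  (fun c => u (dual_actr f c) : K^o) \in dual_pred C.
Proof.
apply: mem_set; split.
  move=> k x y; rewrite -dual_linear; congr (u _); apply: dual_ext => d.
  by rewrite dual_addE dual_scaleE !dual_actrE bmulDl bmulZl dualD dualZ.
exists (`|u| * `|f|) => x; rewrite -mulrA (le_trans (ler_dual _ _))//.
by rewrite ler_wpM2l// ler_dual_actr.
Qed.

(* <u.f, c> = <u, f.c> *)
Definition bidual_act (u : C'') (f : C') : C' := Dual hK (bidual_act_subproof u f).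

Lemma bidual_actE u f c : bidual_act u f c = u (dual_actr f c).
Proof. by []. Qed.

Lemma ler_bidual_act u f : `|bidual_act u f| <= `|u| * `|f|.
Proof.
rewrite dual_normE; apply: dual_norm_le => [|x]; first by rewrite mulr_ge0.
rewrite bidual_actE -mulrA (le_trans (ler_dual _ _))// ler_wpM2l//.
exact: ler_dual_actr.
Qed.

Lemma bidual_act_linear u k f g :
  bidual_act u (k *: f + g) = k *: bidual_act u f + bidual_act u g.
Proof.
apply: dual_ext => c; rewrite dual_addE dual_scaleE !bidual_actE -dualZ -dualD.
by congr (u _); apply: dual_ext.
Qed.

Lemma arens_subproof (u v : C'') :
  (fun f => u (bidual_act v f) : K^o) \in dual_pred C'.
Proof.
apply: mem_set; split.
  by move=> k f g; rewrite bidual_act_linear dual_linear.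
exists (`|u| * `|v|) => f; rewrite -mulrA (le_trans (ler_dual _ _))//.
by rewrite ler_wpM2l// ler_bidual_act.
Qed.

(* First Arens product: <uv, f> = <u, v.f> *)
Definition arens (u v : C'') : C'' := Dual hK (arens_subproof u v).

Lemma arensE u v f : arens u v f = u (bidual_act v f). Proof. by []. Qed.

Lemma bidual_act_arens u v f :
  bidual_act (arens u v) f = bidual_act u (bidual_act v f).
Proof.
apply: dual_ext => c; rewrite !bidual_actE arensE; congr (u _).
apply: dual_ext => d; rewrite dual_actrE !bidual_actE; congr (v _).
by apply: dual_ext => e; rewrite !dual_actrE bmulA.
Qed.

Lemma arensA : associative arens.
Proof. by move=> u v w; apply: dual_ext => f; rewrite !arensE bidual_act_arens. Qed.

Lemma arensDl : left_distributive arens +%R.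
Proof. by move=> u v w; apply: dual_ext. Qed.

Lemma arensDr : right_distributive arens +%R.
Proof.
move=> u v w; apply: dual_ext => f; rewrite dual_addE !arensE -dualD.
by congr (u _); apply: dual_ext.
Qed.

Lemma arensZl (k : K) u v : arens (k *: u) v = k *: arens u v.
Proof. by apply: dual_ext. Qed.

Lemma arensZr (k : K) u v : arens u (k *: v) = k *: arens u v.
Proof.
apply: dual_ext => f; rewrite dual_scaleE !arensE -dualZ.
by congr (u _); apply: dual_ext.
Qed.

Lemma ler_arens u v : `|arens u v| <= `|u| * `|v|.
Proof.
rewrite dual_normE; apply: dual_norm_le => [|f]; first by rewrite mulr_ge0.
by rewrite arensE -mulrA (le_trans (ler_dual _ _))// ler_wpM2l// ler_bidual_act.
Qed.

HB.instance Definition _ := isBanachAlgebra.Build K (dual hK (dual hK C))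
  arensA arensDl arensDr arensZl arensZr ler_arens.

End Actions.

(* The Banach algebra A^(n) for even n: dual_alg hK A n.+2 is convertible to the
   bidual of dual_alg hK A n.  For odd n the value is that at n - 1 and has no
   meaning. *)
Definition dual_alg (K : numFieldType) (hK : real_complete K)
    (A : banachAlgType K) (n : nat) : banachAlgType K :=
  iter n./2 (fun C : banachAlgType K => dual hK (dual hK C) : banachAlgType K) A.

Lemma dual_algSS (K : numFieldType) (hK : real_complete K)
    (A : banachAlgType K) (n : nat) :
  dual_alg hK A n.+2 = dual hK (dual hK (dual_alg hK A n)).
Proof. by []. Qed.

(* sigma(V', V) on V' *)
Definition weak_star (K : numFieldType) (hK : real_complete K)
    (V : normedModType K) : Type :=
  initial_topology (fun f : dual hK V => (f : {ptws V -> K^o})).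

HB.instance Definition _ K hK V := Topological.on (@weak_star K hK V).

(* sigma(V, V') on V *)
Definition weak (K : numFieldType) (hK : real_complete K)
    (V : normedModType K) : Type :=
  initial_topology
    (fun x : V => (fun f : dual hK V => f x) : {ptws dual hK V -> K^o}).

HB.instance Definition _ K hK V := Topological.on (@weak K hK V).

Section WeakTopologies.
Variables (K : numFieldType) (hK : real_complete K) (V : normedModType K).

Lemma continuous_to_ptws (X : topologicalType) (I : eqType)
    (h : X -> {ptws I -> K^o}) :
  continuous h <-> forall i, continuous (fun x => h x i : K^o).
Proof.
split=> [ch i|ch x].
  have pc := @proj_continuous I (fun=> K^o : topologicalType) i.
  move=> x; apply: (@continuous_comp _ _ _ h (@proj I (fun=> K^o) i)); first exact: ch.
  exact: (pc (h x)).
apply/cvg_sup => i; move: x.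
apply: (@continuous_comp_initial (I -> K^o) X K^o (fun f => f i) h).
exact: ch.
Qed.

Lemma continuous_weak_star (X : topologicalType) (h : X -> weak_star hK V) :
  continuous h <-> forall v : V, continuous (fun x => (h x : dual hK V) v : K^o).
Proof.
split=> [ch|ch].
  apply/(@continuous_to_ptws _ _ (fun x => dual_val (h x : dual hK V))) => x.
  apply: (@continuous_comp _ (weak_star hK V) {ptws V -> K^o} h); first exact: ch.
  exact: (@initial_continuous _ _ (fun f : dual hK V => (f : {ptws V -> K^o})) (h x)).
by apply: continuous_comp_initial; apply/continuous_to_ptws.
Qed.

Lemma continuous_weak (X : topologicalType) (h : X -> weak hK V) :
  continuous h <-> forall f : dual hK V, continuous (fun x => f (h x) : K^o).
Proof.
split=> [ch|ch].
  apply/(@continuous_to_ptws _ _ (fun x (f : dual hK V) => f (h x))) => x.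
  apply: (@continuous_comp _ (weak hK V) {ptws dual hK V -> K^o} h
    (fun x : V => (fun f : dual hK V => f x))); first exact: ch.
  exact: (@initial_continuous _ _
    (fun x : V => (fun f : dual hK V => f x) : {ptws dual hK V -> K^o}) (h x)).
by apply: continuous_comp_initial; apply/continuous_to_ptws.
Qed.

End WeakTopologies.

(* With C = A^(n-2): sigma(C'', C') is the weak* topology and sigma(C'', C''')
   the weak topology of C'' = A^(n). *)
Definition Ztilde1l_bidual (K : numFieldType) (hK : real_complete K)
    (C : banachAlgType K) : set (dual hK (dual hK C)) :=
  [set a | continuous ((fun b : dual hK (dual hK C) => bmul a b)
             : weak_star hK (dual hK C) -> weak hK (dual hK (dual hK C)))].

Arguments Ztilde1l_bidual {K} hK C _.

(* Only meaningful for even n >= 2. *)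
Definition Ztilde1l (K : numFieldType) (hK : real_complete K)
    (A : banachAlgType K) (n : nat) : set (dual_alg hK A n) :=
  match n return set (dual_alg hK A n) with
  | m.+2 => Ztilde1l_bidual hK (dual_alg hK A m)
  | _ => set0
  end.

Arguments Ztilde1l {K} hK A n _.

Definition derivation (K : numFieldType) (hK : real_complete K)
    (C : banachAlgType K) (D : C -> dual hK C) : Prop :=
  bounded_linear D /\
  forall x y, D (bmul x y) = dual_actl x (D y) + dual_actr (D x) y.

Definition inner (K : numFieldType) (hK : real_complete K)
    (C : banachAlgType K) (D : C -> dual hK C) : Prop :=
  exists f : dual hK C, forall c, D c = dual_actl c f - dual_actr f c.

Definition weakly_amenable (K : numFieldType) (hK : real_complete K)
    (C : banachAlgType K) : Prop :=
  forall D : C -> dual hK C, derivation D -> inner D.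

(* Main.v *)
Require Import Defs.
From HB Require Import structures.
From mathcomp Require Import all_boot all_order all_algebra.
From mathcomp Require Import mathcomp_extra boolp classical_sets functions reals.
From mathcomp Require Import topology normedtype.

Set Implicit Arguments.
Unset Strict Implicit.
Unset Printing Implicit Defensive.

Local Open Scope classical_set_scope.

(** Write C for A^(n-2), so that A^(n) is the bidual C'' with the first Arens
product, and let D : C -> C' be a derivation.  The idea is to extend D to its
second transpose D'' : C'' -> C''', to see that D'' is again a derivation, and
to pull a functional F on C'' implementing D'' back to C along the canonical
embedding C -> C'', which is multiplicative.

The derivation identity for D'' is where the hypothesis on the product of C''
enters.  Unfolding the Arens product, and writing D' : C'' -> C' for
w |-> (c |-> <w, D c>), one finds
<D''(uv), w> = <D''(u) v, w> + <u, c |-> <D''v, wc>>, whereas the identity calls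
for <D''v, wu> as second term.  The two agree as soon as the functional
b |-> <D''v, wb> on C'' is the evaluation at an element g of C': then
c |-> <D''v, wc> is g itself and both sides are u(g).  Now this functional is
weak*-continuous, since b |-> wb is weak*-to-weak continuous, and every
weak*-continuous functional on a dual space is an evaluation
([weak_star_continuous_canon]); this gives [Ztilde1l_actr_canon], from which
[transpose2_derivation] follows.  The passage from D'' back to D is in
[weakly_amenable_bidual]. *)

Import Order.TTheory GRing.Theory Num.Theory.
Import numFieldNormedType.Exports.

Local Open Scope ring_scope.

(** * Transposes and the canonical embedding *)

Section Transpose.
Variables (K : numFieldType) (hK : real_complete K) (V W : normedModType K).

Lemma transpose_subproof (T : V -> W) (hT : bounded_linear T) (g : dual hK W) :
  (fun x => g (T x) : K^o) \in dual_pred V.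
Proof.
apply: mem_set; have [Tlin [M hM]] := hT; split.
  by move=> k x y; rewrite Tlin dual_linear.
exists (`|g| * M) => x; rewrite -mulrA (le_trans (ler_dual _ _))//.
by rewrite ler_wpM2l.
Qed.

Definition transpose (T : V -> W) (hT : bounded_linear T) (g : dual hK W) :
  dual hK V := Dual hK (transpose_subproof hT g).

Lemma transposeE (T : V -> W) (hT : bounded_linear T) g x :
  transpose hT g x = g (T x).
Proof. by []. Qed.

Lemma transpose_bounded_linear (T : V -> W) (hT : bounded_linear T) :
  bounded_linear (transpose hT).
Proof.
split; first by move=> k f g; exact: dual_ext.
have [_ [M hM]] := hT; exists `|M| => g.
(* the constant M may be negative when V = 0, hence the absolute value *)
rewrite [leLHS]dual_normE; apply: dual_norm_le => [|x]; first by rewrite mulr_ge0.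
rewrite transposeE (le_trans (ler_dual _ _))// mulrC -mulrAC ler_wpM2r//.
have h0 : 0 <= M * `|x| by exact: le_trans (hM x).
by rewrite (le_trans (hM x))// -(ger0_norm h0) normrM normr_id.
Qed.

End Transpose.

Section Canon.
Variables (K : numFieldType) (hK : real_complete K) (V : normedModType K).

Lemma canon_subproof (x : V) :
  (fun f : dual hK V => f x : K^o) \in dual_pred (dual hK V).
Proof.
apply: mem_set; split; first by [].
by exists `|x| => f; rewrite mulrC ler_dual.
Qed.

Definition canon (x : V) : dual hK (dual hK V) := Dual hK (canon_subproof x).

Lemma canonE x f : canon x f = f x. Proof. by []. Qed.

Lemma canon_bounded_linear : bounded_linear canon.
Proof.
split; first by move=> k x y; apply: dual_ext => f; rewrite canonE dual_linear.
exists 1 => x; rewrite mul1r [leLHS]dual_normE; apply: dual_norm_le => // f.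
by rewrite canonE mulrC ler_dual.
Qed.

End Canon.

Lemma canonM (K : numFieldType) (hK : real_complete K) (C : banachAlgType K)
    (c d : C) :
  bmul (canon hK c : dual hK (dual hK C)) (canon hK d) = canon hK (bmul c d).
Proof. exact: dual_ext. Qed.

(** * Weak*-continuous functionals are evaluations *)

Section WeakStarDual.
Variables (K : numFieldType) (hK : real_complete K) (V : normedModType K).
Local Notation V' := (dual hK V).

(** Induction on s: either x adds no constraint on the common kernel of the
remaining vectors, or some f0 in this kernel has f0 x != 0, and then
subtracting from phi the evaluation at a multiple of x, chosen so that the
difference kills f0, gives a functional vanishing on the whole kernel. *)
Lemma canon_span (s : seq V) (phi : dual hK V') :
  (forall f : V', (forall x, x \in s -> f x = 0) -> phi f = 0) ->
  exists x, phi = canon hK x.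
Proof.
elim: s phi => [|x s IH] phi hphi.
  by exists 0; apply: dual_ext => f; rewrite canonE dual0 hphi.
have [[f0 [f0s f0x]]|nof] :=
    pselect (exists f0 : V', (forall y, y \in s -> f0 y = 0) /\ f0 x != 0).
  pose k : K := phi f0 / f0 x.
  have [|y hy] := IH (phi - canon hK (k *: x)).
    move=> f fs; pose l : K := f x / f0 x.
    have /eqP : phi (f - l *: f0) = 0.
      apply: hphi => z; rewrite inE dual_subE dual_scaleE => /predU1P[->|zs].
        by rewrite divfK ?subrr.
      by rewrite fs// f0s// mulr0 subr0.
    rewrite dualB dualZ subr_eq0 => /eqP phif.
    apply/eqP; rewrite dual_subE canonE dualZ phif subr_eq0 /k /l.
    by rewrite mulrAC [f x * _]mulrC mulrAC.
  exists (k *: x + y); apply: dual_ext => f.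
  rewrite canonE dualD addrC -[f y]/(canon hK y f) -hy dual_subE canonE.
  by rewrite subrK.
apply: IH => f fs; apply: hphi => z; rewrite inE => /predU1P[->|/fs//].
by apply/eqP; apply: contrapT => /negP fx; apply: nof; exists f.
Qed.

(** The sets containing the annihilator of a finite set form a filter converging
weak* to 0, so a weak*-continuous functional is bounded by 1 on some such
annihilator; being bounded on a subspace, it vanishes there. *)
Lemma weak_star_continuous_canon (phi : dual hK V') :
  continuous (phi : weak_star hK V -> K^o) -> exists x, phi = canon hK x.
Proof.
move=> cphi.
pose ann (s : seq V) : set V' := [set f | forall x, x \in s -> f x = 0].
pose G : set_system V' := filter_from setT ann.
have FG : Filter G.
  apply: filter_from_filter; first by exists [::].
  move=> s t _ _; exists (s ++ t) => // f fst.
  by split=> x xs; apply: fst; rewrite mem_cat xs ?orbT.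
have G0 : G --> (0 : weak_star hK V).
  move=> U [_ /= [[O oO <-]] O0 /filterS]; apply.
  have : (fun f : V' => (f : {ptws V -> K^o})) @ G -->
      (dual_val (0 : V') : {ptws V -> K^o}).
    apply/pointwise_cvgP => x S /nbhs_singleton S0.
    by exists [:: x] => // f fx; rewrite /= fx ?inE.
  by apply; exact: open_nbhs_nbhs.
have /cvgrPdist_lt/(_ 1 ltr01) : phi @ G --> phi 0.
  exact: cvg_comp G0 (cphi _).
case=> s _ hs; apply: (@canon_span s) => f fs.
apply/eqP; apply: contrapT => /negP phif.
have /= : `|phi 0 - phi ((phi f)^-1 *: f)| < 1.
  by apply: hs => x xs; rewrite dual_scaleE fs// mulr0.
by rewrite dual0 dualZ mulVf// sub0r normrN normr1 ltxx.
Qed.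

End WeakStarDual.

(** * The second transpose of a derivation *)

Section SecondTranspose.
Variables (K : numFieldType) (hK : real_complete K) (C : banachAlgType K).
Local Notation C' := (dual hK C).
Local Notation C'' := (dual hK C').

Lemma Ztilde1l_actr_canon (w : C'') (F : dual hK C'') :
  Ztilde1l_bidual hK C w -> exists g : C', dual_actr F w = canon hK g.
Proof.
move=> /continuous_weak/(_ F) cFw.
exact: weak_star_continuous_canon.
Qed.

Hypothesis hZ : Ztilde1l_bidual hK C = setT.

Section Derivation.
Variables (D : C -> C') (hD : derivation D).

Let D' : C'' -> C' := transpose hD.1.
Let D'' : C'' -> dual hK C'' := transpose (transpose_bounded_linear hK hD.1).

(** Both sides are compared at w, peeling off u, then v: the identity reduces to
the derivation rule for D at a pair of elements of C. *)
Lemma transpose2_derivation : derivation D''.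
Proof.
split; first exact: transpose_bounded_linear.
move=> u v; apply: dual_ext => w.
have [|g hg] := @Ztilde1l_actr_canon w (D'' v); first by rewrite hZ.
(* used for b = u on the right-hand side and for b in C on the left-hand one *)
have gE b : (b : C'') g = D'' v (bmul w b).
  by rewrite -[RHS]/(dual_actr (D'' v) w b) hg.
rewrite dual_addE dual_actlE dual_actrE -gE.
rewrite -[LHS]/(u (bidual_act v (D' w))) -[D'' u _]/(u (D' (bmul v w))) -dualD.
congr (u _); apply: dual_ext => c; rewrite dual_addE.
rewrite -[g c]/(canon hK c g) gE.
rewrite -[D'' v _]/(v (D' (bmul w (canon hK c)))).
rewrite -[D' (bmul v w) c]/(v (bidual_act w (D c))) -dualD bidual_actE.
congr (v _); apply: dual_ext => d.
rewrite dual_addE dual_actrE -[LHS]/(w (D (bmul c d))) hD.2 dualD.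
rewrite bidual_actE; congr (w _ + w _).
exact: dual_ext.
Qed.

End Derivation.

(** If F implements D'', then the restriction of F to C implements D, because
D'' restricted to C is D followed by the canonical embedding of C' into C'''. *)
Lemma weakly_amenable_bidual :
  weakly_amenable hK (C'' : banachAlgType K) -> weakly_amenable hK C.
Proof.
move=> hwa D hD; have [F hF] := hwa _ (transpose2_derivation hD).
exists (transpose (canon_bounded_linear hK C) F) => c; apply: dual_ext => d.
have := dual_subE (dual_actl (canon hK c : C'') F)
  (dual_actr F (canon hK c : C'')) (canon hK d).
by rewrite -hF [X in _ = X - _]dual_actlE [X in _ = _ - X]dual_actrE !canonM.
Qed.

End SecondTranspose.

Theorem mainTheorem6 (K : numFieldType) (hK : real_complete K)
    (A : banachAlgType K) (n : nat) (hn : (2 <= n)%N) (n_even : ~~ odd n)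
    (hZ : Ztilde1l hK A n = [set: dual_alg hK A n])
    (hwa : weakly_amenable hK (dual_alg hK A n)) :
  weakly_amenable hK (dual_alg hK A (n - 2)).
Proof.
case: n hn {n_even} hZ hwa => [|[|m]]// _ hZ hwa; rewrite subn2 /=.
exact: weakly_amenable_bidual hZ hwa.
Qed.
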